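(* Let $X, Y$ be Banach spaces over $\mathbb{K}$. Suppose that $(X^*\times Y,\mathbb{K})$ has property $\mathbf{L}_{o,o}$ for bilinear forms. Then every nuclear operator from $X$ into $Y$ can be approximated in the nuclear norm by nuclear operators which attain their nuclear norm; that is, $\overline{\operatorname{NA}_{\mathcal{N}}(X,Y)}^{\|\cdot\|_N}=\mathcal{N}(X,Y)$.
   Context: $\mathbb{K}$ is $\mathbb{R}$ or $\mathbb{C}$; $S_Z$ is the unit sphere of $Z$. For Banach spaces $E,F$, the pair $(E\times F,\mathbb{K})$ has property $\mathbf{L}_{o,o}$ for bilinear forms if for every $\varepsilon>0$ and every bounded bilinear form $B: E\times F\to\mathbb{K}$ with $\|B\|=\sup_{S_E\times S_F}|B|=1$, there exists $\eta(\varepsilon,B)>0$ such that whenever $(x,y)\in S_E\times S_F$ satisfies $|B(x,y)|>1-\eta(\varepsilon,B)$, there is $(x_0,y_0)\in S_E\times S_F$ with $|B(x_0,y_0)|=1$, $\|x-x_0\|<\varepsilon$ and $\|y-y_0\|<\varepsilon$. $\mathcal{N}(X,Y)$ is the space of nuclear operators, i.e. operators of the form $T(x)=\sum_{n=1}^\infty x_n^*(x)y_n$ (written $T=\sum_n x_n^*\otimes y_n$) with $(x_n^* )\subseteq X^*$, $(y_n)\subseteq Y$ bounded and $\sum_n\|x_n^*\|\|y_n\|<\infty$; the nuclear norm $\|T\|_N$ is the infimum of $\sum_n\|x_n^*\|\|y_n\|$ over all such representations. $\operatorname{NA}_{\mathcal{N}}(X,Y)$ is the set of $T\in\mathcal{N}(X,Y)$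 which attain their nuclear norm, i.e. for which there is such a representation with $\|T\|_N=\sum_n\|x_n^*\|\|y_n\|$. *)

(* Defs.v *)
From HB Require Import structures.
From mathcomp Require Import all_boot all_order all_algebra.
From mathcomp Require Import all_classical all_reals all_analysis.
From mathcomp Require Import complex.

Set Implicit Arguments.
Unset Strict Implicit.
Unset Printing Implicit Defensive.

Import Order.TTheory GRing.Theory Num.Theory.
Import numFieldNormedType.Exports.

Local Open Scope classical_set_scope.
Local Open Scope ring_scope.

Variant scalar_kind := RealScalars | ComplexScalars.

Definition scalars (R : realType) (k : scalar_kind) : numFieldType :=
  match k with RealScalars => R | ComplexScalars => R[i] end.

(* Norms in a [normedModType K] take values in [K]. To take suprema, infima
   and infinite sums of norms also when K = R[i], they are read in [R]. *)
Definition real_part (R : realType) (k : scalar_kind) : scalars R k -> R :=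
  match k with RealScalars => id | ComplexScalars => @complex.Re R end.

Definition of_real (R : realType) (k : scalar_kind) : R -> scalars R k :=
  match k with
  | RealScalars => id
  | ComplexScalars => fun r => real_complex R r
  end.

Definition rnorm (R : realType) (k : scalar_kind)
  (V : normedModType (scalars R k)) (x : V) : R := real_part `|x|.

Section rnorm_theory.
Context {R : realType} {k : scalar_kind}.
Local Notation K := (scalars R k).
Implicit Type V : normedModType K.

Lemma of_realK : cancel (@of_real R k) (@real_part R k).
Proof. by case: k. Qed.

Lemma of_realD : {morph @of_real R k : x y / x + y}.
Proof. by case: k => //= x y; rewrite rmorphD. Qed.

Lemma of_realM : {morph @of_real R k : x y / x * y}.
Proof. by case: k => //= x y; rewrite rmorphM. Qed.

Lemma of_real0 : @of_real R k 0 = 0.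
Proof. by case: k. Qed.

Lemma of_real1 : @of_real R k 1 = 1.
Proof. by case: k. Qed.

Lemma ler_of_real : {mono @of_real R k : x y / x <= y}.
Proof. by case: k => //= x y; rewrite lecR. Qed.

Lemma real_partK (a : K) : 0 <= a -> of_real k (real_part a) = a.
Proof.
move: a; case: k => //= -[a b] /=.
by rewrite lecE /= => /andP[/eqP -> _].
Qed.

Lemma of_rnorm V (x : V) : of_real k (rnorm x) = `|x|.
Proof. exact: real_partK. Qed.

Lemma rnorm_le V (x : V) (r : R) : (rnorm x <= r) = (`|x| <= of_real k r).
Proof. by rewrite -of_rnorm ler_of_real. Qed.

Lemma rnorm_ge0 V (x : V) : 0 <= rnorm x.
Proof. by rewrite -ler_of_real of_rnorm of_real0. Qed.

Lemma rnormD V (x y : V) : rnorm (x + y) <= rnorm x + rnorm y.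
Proof. by rewrite rnorm_le of_realD !of_rnorm ler_normD. Qed.

Lemma rnormZ V (a : K) (x : V) :
  rnorm (a *: x) = rnorm (a : K^o) * rnorm x.
Proof.
apply: (can_inj of_realK).
by rewrite of_realM !of_rnorm normrZ.
Qed.

Lemma rnorm_eq0 V (x : V) : rnorm x = 0 -> x = 0.
Proof.
by move=> x0; apply/normr0_eq0; rewrite -of_rnorm x0 of_real0.
Qed.

Lemma rnorm0 V : rnorm (0 : V) = 0.
Proof. by apply: (can_inj of_realK); rewrite of_rnorm of_real0 normr0. Qed.

End rnorm_theory.

Section dual.
Context {R : realType} {k : scalar_kind}.
Local Notation K := (scalars R k).
Variable X : normedModType K.

Definition dual_pred : {pred (X -> K^o)} :=
  fun f => `[< linear f /\ continuous f >].

Record dual := Dual { dual_fun :> X -> K^o ; _ : dual_fun \in dual_pred }.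

HB.instance Definition _ := [isSub for dual_fun].
HB.instance Definition _ := [Choice of dual by <:].

Lemma dual_pred_submod_closed : submod_closed dual_pred.
Proof.
split.
  apply/asboolP; split; last by move=> x; exact: cst_continuous.
  by move=> a x y /=; rewrite scaler0 addr0.
move=> a f g /asboolP[lf cf] /asboolP[lg cg]; apply/asboolP; split.
  move=> b x y; rewrite !fctE lf lg !scalerDr !scalerA addrACA.
  by rewrite (mulrC a b).
by move=> x; apply: cvgD; [apply: cvgZl_tmp; exact: cf|exact: cg].
Qed.

HB.instance Definition _ :=
  GRing.isSubmodClosed.Build _ _ dual_pred dual_pred_submod_closed.
HB.instance Definition _ := [SubChoice_isSubLmodule of dual by <:].

Definition dual_norm (f : dual) : R :=
  sup [set rnorm (f x) | x in [set x : X | rnorm x <= 1]].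

Lemma dual_linear (f : dual) : linear f.
Proof. by case: f => f /= /asboolP[]. Qed.

Lemma dual_continuous (f : dual) : continuous f.
Proof. by case: f => f /= /asboolP[]. Qed.

Lemma dualD (f g : dual) x : (f + g) x = f x + g x.
Proof. by []. Qed.

Lemma dualZ (a : K) (f : dual) x : (a *: f) x = a *: f x.
Proof. by []. Qed.

Lemma dual_funZ (f : dual) (a : K) x : f (a *: x) = a *: f x.
Proof.
have f0 : f 0 = 0.
  have /eqP := dual_linear f 1 0 0.
  by rewrite !scale1r addr0 eq_sym -subr_eq0 addrK => /eqP.
by have := dual_linear f a x 0; rewrite !addr0 f0 addr0.
Qed.

Lemma dual_bounded (f : dual) :
  exists M : R, forall x, rnorm x <= 1 -> rnorm (f x) <= M.
Proof.
pose lf : {linear X -> K^o} :=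
  HB.pack (dual_fun f) (GRing.isLinear.Build _ _ _ _ _ (dual_linear f)).
have : bounded_near lf (nbhs 0).
  by apply: continuous_linear_bounded; exact: dual_continuous.
move=> /bounded_funP/(_ 1)[M fM]; exists (real_part M) => x x1.
have x1' : `|x| <= 1 by move: x1; rewrite rnorm_le of_real1.
have fxM := fM _ x1'.
by rewrite rnorm_le real_partK// (le_trans _ fxM).
Qed.

Lemma dual_norm_has_sup (f : dual) :
  has_sup [set rnorm (f x) | x in [set x : X | rnorm x <= 1]].
Proof.
split; first by exists (rnorm (f 0)), 0 => //=; rewrite rnorm0.
by have [M fM] := dual_bounded f; exists M => _ [x x1 <-]; exact: fM.
Qed.

Lemma dual_norm_ub (f : dual) x : rnorm x <= 1 -> rnorm (f x) <= dual_norm f.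
Proof.
by move=> x1; apply: sup_upper_bound; [exact: dual_norm_has_sup|exists x].
Qed.

Lemma dual_norm_le (f : dual) M :
  (forall x, rnorm x <= 1 -> rnorm (f x) <= M) -> dual_norm f <= M.
Proof.
move=> fM; apply: ge_sup; first by case: (dual_norm_has_sup f).
by move=> _ [x x1 <-]; exact: fM.
Qed.

Lemma dual_normD (f g : dual) : dual_norm (f + g) <= dual_norm f + dual_norm g.
Proof.
apply: dual_norm_le => x x1; rewrite dualD (le_trans (rnormD _ _))//.
by rewrite lerD// dual_norm_ub.
Qed.

Lemma dual_normZ_le (a : K) (f : dual) :
  dual_norm (a *: f) <= rnorm (a : K^o) * dual_norm f.
Proof.
apply: dual_norm_le => x x1; rewrite dualZ rnormZ.
by rewrite ler_wpM2l ?rnorm_ge0// dual_norm_ub.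
Qed.

Lemma dual_normZ (a : K) (f : dual) :
  dual_norm (a *: f) = rnorm (a : K^o) * dual_norm f.
Proof.
have dn0 g : 0 <= dual_norm g.
  by rewrite (le_trans (rnorm_ge0 (g 0)))// dual_norm_ub// rnorm0.
apply/eqP; rewrite eq_le dual_normZ_le/=.
have [->|a0] := eqVneq a 0.
  by rewrite (rnorm0 K^o) mul0r dn0.
have na0 : 0 < rnorm (a : K^o).
  rewrite lt_neqAle rnorm_ge0 andbT eq_sym.
  by apply: contra a0 => /eqP/rnorm_eq0 ->.
have := dual_normZ_le a^-1 (a *: f); rewrite scalerA mulVf// scale1r.
have -> : rnorm (a^-1 : K^o) = (rnorm (a : K^o))^-1.
  apply: (mulfI (lt0r_neq0 na0)); rewrite mulfV ?lt0r_neq0//.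
  rewrite -(rnormZ (a : K) (a^-1 : K^o)) /GRing.scale/= mulfV//.
  by apply: (can_inj (@of_realK R k)); rewrite of_rnorm normr1 of_real1.
by rewrite ler_pdivlMl.
Qed.

Lemma dual_norm_eq0 (f : dual) : dual_norm f = 0 -> f = 0.
Proof.
move=> f0; apply: val_inj; apply/funext => x /=.
have [->|x0] := eqVneq x 0.
  by have := dual_funZ f 0 0; rewrite !scale0r.
have nx0 : `|x| != 0 by rewrite normr_eq0.
have : rnorm (f (`|x|^-1 *: x)) <= 0.
  rewrite -f0 dual_norm_ub// rnorm_le normrZ normfV normr_id mulVf//.
  by rewrite of_real1.
rewrite le_eqVlt ltNge rnorm_ge0 orbF => /eqP/rnorm_eq0.
rewrite dual_funZ => /eqP; rewrite scaler_eq0 invr_eq0 (negbTE nx0)/=.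
by move=> /eqP.
Qed.

Fact dual_normK_triangle (f g : dual) :
  of_real k (dual_norm (f + g)) <=
  of_real k (dual_norm f) + of_real k (dual_norm g).
Proof. by rewrite -of_realD ler_of_real dual_normD. Qed.

Fact dual_normK_scale (a : K) (f : dual) :
  of_real k (dual_norm (a *: f)) = `|a| * of_real k (dual_norm f).
Proof. by rewrite dual_normZ of_realM (of_rnorm (a : K^o)). Qed.

Fact dual_normK_eq0 (f : dual) : of_real k (dual_norm f) = 0 -> f = 0.
Proof.
by rewrite -(of_real0 (R := R)) => /(can_inj of_realK)/dual_norm_eq0.
Qed.

HB.instance Definition _ := @Lmodule_isNormed.Build K dual
  (fun f => of_real k (dual_norm f))
  dual_normK_triangle dual_normK_scale dual_normK_eq0.

Lemma rnorm_dual (f : dual) : rnorm f = dual_norm f.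
Proof. exact: of_realK. Qed.

End dual.

Definition unit_sphere (R : realType) (k : scalar_kind)
  (V : normedModType (scalars R k)) : set V := [set x | rnorm x = 1].
Arguments unit_sphere {R k} V _.

Section property_Loo.
Context {R : realType} {k : scalar_kind}.
Local Notation K := (scalars R k).
Variables E F : normedModType K.

Definition form_values (B : {bilinear E -> F -> K^o}) : set R :=
  [set rnorm (B p.1 p.2) | p in unit_sphere E `*` unit_sphere F].

Definition bounded_form (B : {bilinear E -> F -> K^o}) :=
  has_ubound (form_values B).

Definition form_norm (B : {bilinear E -> F -> K^o}) : R := sup (form_values B).

Definition property_Loo : Prop :=
  forall (e : R) (B : {bilinear E -> F -> K^o}),
    0 < e -> bounded_form B -> form_norm B = 1 ->
    exists2 eta : R, 0 < eta &
      forall x y, unit_sphere E x -> unit_sphere F y ->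
        1 - eta < rnorm (B x y) ->
        exists x0 y0, [/\ unit_sphere E x0, unit_sphere F y0,
          rnorm (B x0 y0) = 1, rnorm (x - x0) < e & rnorm (y - y0) < e].

End property_Loo.

Section nuclear.
Context {R : realType} {k : scalar_kind}.
Local Notation K := (scalars R k).
Variables X Y : normedModType K.

Definition rep_weight (f : nat -> dual X) (y : nat -> Y) : \bar R :=
  (\sum_(0 <= n <oo) (rnorm (f n) * rnorm (y n))%:E)%E.

Definition nuclear_rep (T : X -> Y) (f : nat -> dual X) (y : nat -> Y) : Prop :=
  [/\ bounded_fun f, bounded_fun y, (rep_weight f y < +oo)%E &
      forall x, series (fun n => f n x *: y n) @ \oo --> T x].

Definition nuclear : set (X -> Y) :=
  [set T | exists f y, nuclear_rep T f y].

(* [ereal_inf set0 = +oo], so this is +oo when T is not nuclear. *)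
Definition nuclear_norm (T : X -> Y) : \bar R :=
  ereal_inf [set w | exists f y, nuclear_rep T f y /\ rep_weight f y = w].

Definition nuclear_attaining : set (X -> Y) :=
  [set T | exists f y, nuclear_rep T f y /\ nuclear_norm T = rep_weight f y].

Definition nuclear_closure (A : set (X -> Y)) : set (X -> Y) :=
  [set T | nuclear T /\ forall e : R, 0 < e ->
     exists2 S, A S & (nuclear_norm (T \- S)%R < e%:E)%E].

End nuclear.
Arguments nuclear {R k} X Y.
Arguments nuclear_attaining {R k} X Y.

(* Main.v *)
Require Import Defs.
From HB Require Import structures.
From mathcomp Require Import all_boot all_order all_algebra.
From mathcomp Require Import all_classical all_reals all_analysis.
From mathcomp Require Import complex ring lra.

Set Implicit Arguments.
Unset Strict Implicit.
Unset Printing Implicit Defensive.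

Import Order.TTheory GRing.Theory Num.Theory.
Import numFieldNormedType.Exports.

Local Open Scope classical_set_scope.
Local Open Scope ring_scope.

(** A nuclear operator [T] of nuclear norm [P > 0] has, by Hahn-Banach, a
    functional [G] on the nuclear operators with [|G S| <= |S|_N] for all [S]
    and [Re G T = P]. Its values on elementary tensors form a bilinear form
    [B f y = G (f (x) y)] on [X^* * Y], of norm at most one because the nuclear
    norm of [f (x) y] is at most [|f| |y|], and of norm at least one because
    [Re G T] is recovered from the values of [B] on any representation of [T]
    (norming_form_norm). So property L_oo applies to [B].

    Take a representation of [T] whose weight exceeds [P] by very little. The
    defects [|f n| |y n| - Re B (f n) (y n)] are nonnegative and their sum is
    at most this excess. Hence, apart from terms of small total weight, which
    are dropped, [B] is almost one at the normalized factors; these are moved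
    to a nearby pair where [B] has modulus one, and rotated so that the value
    of [B] becomes one (replace_tensor). Keeping only finitely many terms, the
    resulting operator [S] is close to [T]. On each of its terms [G] takes the
    value [|g| |z|], so the sum of these is both the weight of a representation
    of [S] and at most [Re G S <= |S|_N]: the nuclear norm of [S] is attained
    (attaining_finite).

    Truncation to finite sums makes every evaluation of [G] a finite one: the
    only limiting fact about representations is that the remainder of [T] has
    nuclear norm at most the tail of the weights (nnorm_remainder). The
    nuclear norm is subadditive because two representations can be interleaved
    (nuclear_repD).

    Hahn-Banach is obtained from minimal sublinear functionals, which are
    total functions, so that no extension of partially defined functionals
    has to be handled; the complex case follows by taking real parts
    (norming_functional). *)

(** * Sublinear functionals and their additive minorants *)

Section hahn_banach.
Context {R : realType} {k : scalar_kind}.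
Local Notation K := (scalars R k).
Local Notation "t *r: x" := (of_real k t *: x) (at level 40).
Variable V : lmodType K.
Implicit Types (p q : V -> R) (x y v : V) (s t : R).

Definition sublinear p :=
  (forall x y, p (x + y) <= p x + p y) /\
  (forall t x, 0 <= t -> p (t *r: x) <= t * p x).

Lemma sublinear0 p : sublinear p -> p 0 = 0.
Proof.
move=> [pD pZ]; apply/eqP; rewrite eq_le; apply/andP; split.
  by have := pZ 0 0 (lexx _); rewrite scaler0 mul0r.
by have := pD 0 0; rewrite addr0; lra.
Qed.

Lemma sublinear_ge p x : sublinear p -> - p (- x) <= p x.
Proof.
move=> sp; have := sp.1 x (- x); rewrite subrr (sublinear0 sp); lra.
Qed.

Lemma sublinearZ p t x : sublinear p -> 0 <= t -> p (t *r: x) = t * p x.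
Proof.
move=> sp; rewrite le_eqVlt => /predU1P[<-|t0].
  by rewrite of_real0 scale0r mul0r (sublinear0 sp).
apply/eqP; rewrite eq_le (sp.2 _ _ (ltW t0))/= -ler_pdivlMl//.
have := sp.2 t^-1 (t *r: x); rewrite scalerA -of_realM mulVf ?gt_eqF//.
by rewrite of_real1 scale1r; apply; rewrite invr_ge0 ltW.
Qed.

(** Pushing a sublinear functional down along the direction [v]: the result
    is the largest sublinear minorant of [q] that is at most [- q v] at
    [- v]. *)
Definition push_down q v x : R :=
  inf [set q (x + t *r: v) - t * q v | t in [set t | 0 <= t]].

Lemma push_down_has_inf q v x : sublinear q ->
  has_inf [set q (x + t *r: v) - t * q v | t in [set t | 0 <= t]].
Proof.
move=> sq; split; first by exists (q (x + 0 *r: v) - 0 * q v), 0 => /=.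
exists (- q (- x)) => _ [t /= t0 <-].
have := sq.1 (x + t *r: v) (- x); rewrite addrAC subrr add0r.
by rewrite sublinearZ//; lra.
Qed.

Lemma push_down_le_at q v x t : sublinear q -> 0 <= t ->
  push_down q v x <= q (x + t *r: v) - t * q v.
Proof.
move=> sq t0; apply: ge_inf; last by exists t.
by case: (push_down_has_inf v x sq).
Qed.

Lemma push_down_le q v x : sublinear q -> push_down q v x <= q x.
Proof.
move=> sq; apply: le_trans (push_down_le_at v x sq (lexx 0)) _.
by rewrite of_real0 scale0r mul0r addr0 subr0.
Qed.

Lemma push_downN q v : sublinear q -> push_down q v (- v) <= - q v.
Proof.
move=> sq; apply: le_trans (push_down_le_at v _ sq ler01) _.
by rewrite of_real1 scale1r addNr (sublinear0 sq) mul1r sub0r.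
Qed.

Lemma push_down_sublinear q v : sublinear q -> sublinear (push_down q v).
Proof.
move=> sq; split=> [x y|t x t0].
  apply/ler_addgt0Pr => e e0; have e20 : 0 < e / 2 by rewrite divr_gt0.
  have [_ [s /= s0 <-] Hs] := inf_adherent e20 (push_down_has_inf v x sq).
  have [_ [t /= t0 <-] Ht] := inf_adherent e20 (push_down_has_inf v y sq).
  apply: le_trans (push_down_le_at v _ sq (addr_ge0 s0 t0)) _.
  have := sq.1 (x + s *r: v) (y + t *r: v).
  rewrite addrACA -scalerDl -of_realD -/(push_down _ _ _).
  by rewrite -/(push_down q v x) in Hs; rewrite -/(push_down q v y) in Ht; lra.
apply/ler_addgt0Pr => e e0.
have e10 : 0 < e / (t + 1) by rewrite divr_gt0// ltr_wpDl.
have [_ [s /= s0 <-] Hs] := inf_adherent e10 (push_down_has_inf v x sq).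
rewrite -/(push_down q v x) in Hs.
apply: le_trans (push_down_le_at v _ sq (mulr_ge0 t0 s0)) _.
rewrite of_realM -scalerA -scalerDr sublinearZ//.
have te : t * (e / (t + 1)) <= e.
  rewrite mulrCA; apply: ler_piMr; first exact: ltW.
  by rewrite ler_pdivrMr ?mul1r ?lerDl// ltr_wpDl.
apply: le_trans (lerD (lexx _) te); rewrite -mulrDr -mulrA -mulrBr.
by rewrite ler_wpM2l// ltW.
Qed.

(** Zorn's lemma: along a nonempty chain of sublinear minorants of [p] the
    values at [x] stay above [- p (- x)], and the pointwise infimum is
    sublinear because any two members of the chain are comparable. *)
Lemma minimal_sublinear p : sublinear p ->
  exists2 q, sublinear q /\ (forall x, q x <= p x) &
    forall q', sublinear q' -> (forall x, q' x <= q x) -> q' = q.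
Proof.
move=> sp; pose minorant q := sublinear q /\ forall x, q x <= p x.
pose T := {q | minorant q}.
pose le (q1 q2 : T) := `[< forall x, sval q2 x <= sval q1 x >].
have [||||q qmin] := @Zorn T le.
- by move=> q; apply/asboolP.
- move=> q1 q2 q3 /asboolP le12 /asboolP le23; apply/asboolP => x.
  exact: le_trans (le23 x) (le12 x).
- move=> [q1 sq1] [q2 sq2] /asboolP/= le12 /asboolP/= le21.
  have eq12 : q1 = q2.
    by apply/funext => x; apply/eqP; rewrite eq_le le12 le21.
  by case: _ / eq12 sq2 {le12 le21} => sq2; congr exist; exact: Prop_irrelevance.
- move=> A Atot; have [[q0 Aq0]|A0] := pselect (exists q : T, A q); last first.
    exists (exist minorant p (conj sp (fun=> lexx _))) => q Aq.
    by case: A0; exists q.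
  pose S x := [set sval (q : T) x | q in A].
  have Sinf x : has_inf (S x).
    split; first by exists (sval q0 x), q0.
    exists (- p (- x)) => _ [q Aq <-]; have [sq qp] := svalP q.
    by apply: le_trans (sublinear_ge x sq); rewrite lerN2.
  have Sle x (q : T) : A q -> inf (S x) <= sval q x.
    by move=> Aq; apply: ge_inf; [case: (Sinf x)|exists q].
  have sS : sublinear (fun x => inf (S x)).
    split=> [x y|t x t0].
      apply/ler_addgt0Pr => e e0; have e20 : 0 < e / 2 by rewrite divr_gt0.
      have [_ [q1 Aq1 <-] H1] := inf_adherent e20 (Sinf x).
      have [_ [q2 Aq2 <-] H2] := inf_adherent e20 (Sinf y).
      have [q [Aq qx qy]] : exists q : T, [/\ A q, sval q x <= sval q1 x &
          sval q y <= sval q2 y].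
        have [/asboolP le12|/asboolP le21] := Atot q1 q2 Aq1 Aq2.
          by exists q2.
        by exists q1.
      have := (svalP q).1.1 x y; have := Sle (x + y) q Aq; lra.
    rewrite -subr_le0 leNgt; apply/negP => d0.
    have t1 : 0 < t + 1 by rewrite ltr_wpDl.
    have e10 : 0 < (inf (S (t *r: x)) - t * inf (S x)) / (t + 1).
      by rewrite divr_gt0.
    have [_ [q Aq <-]] := inf_adherent e10 (Sinf x).
    rewrite -ltrBlDl ltr_pdivlMr//.
    have := Sle _ _ Aq : inf (S (t *r: x)) <= _.
    have := Sle x _ Aq; have := (svalP q).1.2 t x t0; nra.
  have Sp x : inf (S x) <= p x.
    by apply: le_trans (Sle x _ Aq0) _; case: (svalP q0).
  exists (exist minorant _ (conj sS Sp)) => q Aq; apply/asboolP => x /=.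
  exact: Sle.
have [sq qp] := svalP q; exists (sval q) => // q' sq' q'q.
have q'p x : q' x <= p x := le_trans (q'q x) (qp x).
by have /(congr1 sval) := qmin (exist minorant q' (conj sq' q'p)) (asboolT q'q).
Qed.

(** A minimal sublinear functional equals all of its push-downs, hence is odd,
    hence additive. Starting from the push-down of [p] along [v] forces the
    value [p v] at [v]. *)
Lemma sublinear_minorant p v : sublinear p ->
  exists q, [/\ {morph q : x y / x + y},
                forall t x, q (t *r: x) = t * q x,
                forall x, q x <= p x & q v = p v].
Proof.
move=> sp.
have [q [sq qp] qmin] := minimal_sublinear (push_down_sublinear v sp).
have qN x : q (- x) = - q x.
  apply/eqP; rewrite eq_le; apply/andP; split; last first.
    by have := sublinear_ge (- x) sq; rewrite opprK.
  rewrite -{1}(qmin _ (push_down_sublinear x sq)) ?push_downN//.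
  by move=> y; exact: push_down_le.
have qlep x : q x <= p x by exact: le_trans (qp x) (push_down_le v x sp).
exists q; split=> // [x y|t x|].
- apply/eqP; rewrite eq_le sq.1/=.
  have := sq.1 (- x) (- y); rewrite -opprD !qN; lra.
- have [t0|t0] := leP 0 t; first exact: sublinearZ.
  have := @sublinearZ q (- t) x sq; rewrite oppr_ge0 (ltW t0) => /(_ isT).
  rewrite (_ : of_real k (- t) = - of_real k t) ?scaleNr ?qN; last first.
    by apply/eqP; rewrite -addr_eq0 -of_realD addNr of_real0.
  by lra.
- apply/eqP; rewrite eq_le qlep/= -lerN2 -qN.
  exact: le_trans (qp _) (push_downN v sp).
Qed.

End hahn_banach.

(** * Real and complex scalars *)

Section scalars_theory.
Context {R : realType} {k : scalar_kind}.
Local Notation K := (scalars R k).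
Implicit Types (a b : K).

Lemma real_partD : {morph @real_part R k : a b / a + b}.
Proof. by case: k => // -[a b] [c d]. Qed.

Lemma real_part0 : real_part (0 : K) = 0.
Proof. by rewrite -(of_real0 (R := R) (k := k)) of_realK. Qed.

Lemma real_part_sum (F : nat -> K) N :
  real_part (\sum_(0 <= n < N) F n) = \sum_(0 <= n < N) real_part (F n).
Proof. exact: (big_morph _ real_partD real_part0). Qed.

Lemma real_partM_of_real (t : R) a :
  real_part (of_real k t * a) = t * real_part a.
Proof. by move: a; case: k => //= -[a b] /=; rewrite mul0r subr0. Qed.

Lemma real_part_le a : real_part a <= rnorm (a : K^o).
Proof.
move: a; case: k => /= a; first exact: ler_norm.
by case: a => a b; rewrite /rnorm /= (le_trans (ler_norm a))//
  -sqrtr_sqr ler_wsqrtr// lerDl sqr_ge0.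
Qed.

Lemma rnormM a b : rnorm (a * b : K^o) = rnorm (a : K^o) * rnorm (b : K^o).
Proof. exact: (rnormZ a (b : K^o)). Qed.

Lemma rnorm_of_real (t : R) : 0 <= t -> rnorm (of_real k t : K^o) = t.
Proof.
move=> t0; apply: (can_inj (@of_realK R k)); rewrite of_rnorm ger0_norm//.
by rewrite -(of_real0 (k := k)) ler_of_real.
Qed.

Lemma rnorm1 : rnorm (1 : K^o) = 1.
Proof. by rewrite -(of_real1 (R := R) (k := k)) rnorm_of_real. Qed.

Lemma rnormV a : a != 0 -> rnorm (a^-1 : K^o) = (rnorm (a : K^o))^-1.
Proof.
move=> a0; have ra0 : rnorm (a : K^o) != 0.
  by apply: contra a0 => /eqP/rnorm_eq0 ->.
by apply: (mulfI ra0); rewrite mulfV// -rnormM mulfV// rnorm1.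
Qed.

(** This is [|1 - b|^2 = 1 - 2 Re b + |b|^2]. *)
Lemma rnorm_1B_sqr (b : K) : rnorm (b : K^o) <= 1 ->
  rnorm (1 - b : K^o) ^+ 2 <= 2 * (1 - real_part b).
Proof.
move: b; case: k => b; rewrite /rnorm/=.
  rewrite ler_norml => /andP[b1 b2].
  by rewrite real_normK ?num_real//; nra.
case: b => x y /=; rewrite !sqr_sqrtr ?addr_ge0 ?sqr_ge0// => xy1.
suff : x ^+ 2 + y ^+ 2 <= 1 by rewrite sub0r; nra.
have xy0 : 0 <= x ^+ 2 + y ^+ 2 by rewrite addr_ge0 ?sqr_ge0.
by rewrite -(sqr_sqrtr xy0) expr_le1// sqrtr_ge0.
Qed.

(** Over the complex numbers, [g = f - i f(i .)] is the only complex-linear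
    functional with real part [f]. *)
Lemma linear_of_real_part (V : lmodType K) (f : V -> R) :
  {morph f : x y / x + y} ->
  (forall t x, f (of_real k t *: x) = t * f x) ->
  exists g : V -> K^o, linear g /\ forall x, real_part (g x) = f x.
Proof.
move: V f; case: k => V f fD fZ.
  by exists f; split=> // a x y; rewrite fD fZ.
exists (fun x => (f x +i* - f ('i%C *: x))%C); split=> // -[a b] x y.
have decomp z : (a +i* b)%C *: z = (real_complex R a) *: z
    + (real_complex R b) *: ('i%C *: z).
  rewrite scalerA -scalerDl; congr (_ *: _).
  by apply/eqP; rewrite eq_complex /=; apply/andP; split; apply/eqP; ring.
have ii z : 'i%C *: ('i%C *: z) = real_complex R (-1) *: z.
  rewrite scalerA; congr (_ *: _).
  by apply/eqP; rewrite eq_complex /=; apply/andP; split; apply/eqP; ring.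
have comm t z : 'i%C *: (real_complex R t *: z) = real_complex R t *: ('i%C *: z).
  by rewrite !scalerA mulrC.
rewrite decomp !scalerDr !comm ii !fD !fZ.
by apply/eqP; rewrite eq_complex /=; apply/andP; split; apply/eqP; ring.
Qed.

Definition seminorm (V : lmodType K) (p : V -> R) :=
  (forall x y, p (x + y) <= p x + p y) /\
  (forall (a : K) x, p (a *: x) <= rnorm (a : K^o) * p x).

(** Hahn-Banach; the bound passes from the real part to the modulus because
    [g x] can be rotated onto the positive half-line. *)
Lemma norming_functional (V : lmodType K) (p : V -> R) v : seminorm p ->
  exists g : {linear V -> K^o},
    (forall x, rnorm (g x) <= p x) /\ real_part (g v) = p v.
Proof.
move=> [pD pZ].
have sp : sublinear p.
  by split=> // t x t0; rewrite (le_trans (pZ _ _))// rnorm_of_real.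
have [f [fD fZ fp fv]] := sublinear_minorant v sp.
have [g0 [lg g0f]] := linear_of_real_part fD fZ.
pose g : {linear V -> K^o} := HB.pack g0 (GRing.isLinear.Build _ _ _ _ g0 lg).
have gf x : real_part (g x) = f x by exact: g0f.
exists g; split=> [x|]; last by rewrite gf.
have [gx0|gx0] := eqVneq (g x) 0.
  rewrite gx0 rnorm0; apply: le_trans (fp x).
  by rewrite -gf gx0 real_part0.
have rgx0 : rnorm (g x) != 0 by apply: contra gx0 => /eqP/rnorm_eq0 ->.
pose a : K := of_real k (rnorm (g x)) * (g x : K)^-1.
have a1 : rnorm (a : K^o) = 1.
  by rewrite rnormM rnormV// rnorm_of_real ?rnorm_ge0// mulfV.
have gax : g (a *: x) = of_real k (rnorm (g x)).
  have -> : g (a *: x) = a * (g x : K) by rewrite linearZ_LR.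
  by rewrite /a mulfVK.
have := le_trans (fp (a *: x)) (pZ a x).
by rewrite a1 mul1r -gf gax of_realK.
Qed.

End scalars_theory.

(** * The nuclear norm as a seminorm on the space of nuclear operators *)

Definition interleave (A : Type) (u v : nat -> A) n :=
  if odd n then v n./2 else u n./2.

Lemma sum_interleave (V : zmodType) (u v : nat -> V) n :
  \sum_(0 <= i < n) interleave u v i =
  \sum_(0 <= i < uphalf n) u i + \sum_(0 <= i < n./2) v i.
Proof.
elim: n => [|n IHn]; first by rewrite /= !big_nil addr0.
rewrite big_nat_recr//= IHn /interleave uphalf_half.
case: (odd n); rewrite /= ?add0n ?add1n.
  by rewrite big_nat_recr//= [in RHS]big_nat_recr//= addrA.
by rewrite [in RHS]big_nat_recr//= addrAC.
Qed.

Lemma cvg_half : n./2 @[n --> \oo] --> \oo.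
Proof.
move=> A [N _ NA]; exists N.*2 => // n /= Nn; apply: NA => /=.
by rewrite -(doubleK N) half_leq.
Qed.

Lemma cvg_uphalf : uphalf n @[n --> \oo] --> \oo.
Proof.
move=> A [N _ NA]; exists N.*2 => // n /= Nn; apply: NA => /=.
by rewrite (leq_trans _ (half_leq (leqnSn n)))// -(doubleK N) half_leq.
Qed.

Section nuclear_theory.
Context {R : realType} {k : scalar_kind}.
Local Notation K := (scalars R k).

Lemma bounded_funE (V : normedModType K) (u : nat -> V) :
  bounded_fun u <-> exists M : R, forall n, rnorm (u n) <= M.
Proof.
have PF : ProperFilter (globally [set: nat]) := globally_properfilter (I : setT 0%N).
split=> [/(ex_bound u)[M uM]|[M uM]].
  exists (real_part M) => n; have unM := uM n I.
  by rewrite rnorm_le real_partK// (le_trans _ unM).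
apply/(ex_bound u); exists (of_real k M) => n _ /=.
by rewrite -rnorm_le.
Qed.

Variables X Y : normedModType K.
Implicit Types (f g : nat -> dual X) (y z : nat -> Y) (T S : X -> Y).

Definition weights f y n : R := rnorm (f n) * rnorm (y n).

Lemma weights_ge0 f y n : 0 <= weights f y n.
Proof. by rewrite mulr_ge0 ?rnorm_ge0. Qed.

Lemma rep_weight_leP f y (w : R) :
  (rep_weight f y <= w%:E)%E <-> forall N, \sum_(0 <= n < N) weights f y n <= w.
Proof.
have w0 n : (0 <= (weights f y n)%:E)%E by rewrite lee_fin weights_ge0.
split=> [fyw N|fyw].
  rewrite -lee_fin -sumEFin; apply: le_trans fyw.
  exact: (@nneseries_lim_ge _ (fun n => (weights f y n)%:E) xpredT 0 N).
apply: lime_le; first by apply: is_cvg_nneseries => n _ _; exact: w0.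
by near=> N; rewrite sumEFin lee_fin.
Unshelve. all: by end_near. Qed.

Lemma rep_weight_ge0 f y : (0 <= rep_weight f y)%E.
Proof. by apply: nneseries_ge0 => n _ _; rewrite lee_fin weights_ge0. Qed.

Lemma nuclear_rep_fin T f y : nuclear_rep T f y ->
  rep_weight f y = (fine (rep_weight f y))%:E.
Proof.
by move=> [_ _ fyoo _]; rewrite fineK// ge0_fin_numE// rep_weight_ge0.
Qed.

Definition nnorm T : R := fine (nuclear_norm T).

Lemma nuclear_norm_ge0 T : (0 <= nuclear_norm T)%E.
Proof. by apply: le_ereal_inf_tmp => _ [f [y [_ <-]]]; exact: rep_weight_ge0. Qed.

Lemma nuclear_norm_le T f y : nuclear_rep T f y ->
  (nuclear_norm T <= rep_weight f y)%E.
Proof. by move=> fyT; apply: ereal_inf_lbound; exists f, y. Qed.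

Lemma nuclear_normE T : nuclear X Y T -> nuclear_norm T = (nnorm T)%:E.
Proof.
move=> [f [y fyT]]; rewrite fineK// ge0_fin_numE ?nuclear_norm_ge0//.
by apply: le_lt_trans (nuclear_norm_le fyT) _; case: fyT.
Qed.

Lemma nnorm_ge0 T : 0 <= nnorm T.
Proof. by rewrite fine_ge0// nuclear_norm_ge0. Qed.

Lemma nuclear_rep_intro T f y (w : R) : bounded_fun f -> bounded_fun y ->
  (forall N, \sum_(0 <= n < N) weights f y n <= w) ->
  (forall x, series (fun n => f n x *: y n) @ \oo --> T x) ->
  nuclear_rep T f y /\ nnorm T <= w.
Proof.
move=> bf by_ /rep_weight_leP fyw fyT.
have rT : nuclear_rep T f y.
  by split=> //; apply: le_lt_trans fyw _; rewrite ltry.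
split=> //; rewrite -lee_fin -nuclear_normE; last by exists f, y.
exact: le_trans (nuclear_norm_le rT) fyw.
Qed.

Lemma nnorm_adherent T (e : R) : nuclear X Y T -> 0 < e ->
  exists f y, nuclear_rep T f y /\ fine (rep_weight f y) < nnorm T + e.
Proof.
move=> nT e0; have nTfin : nuclear_norm T \is a fin_num by rewrite nuclear_normE.
have [_ [f [y [fyT <-]]] fye] := lb_ereal_inf_adherent e0 nTfin.
exists f, y; split=> //; rewrite -lte_fin -(nuclear_rep_fin fyT) EFinD.
by rewrite -nuclear_normE.
Qed.

Lemma nuclear_rep_weights T f y N : nuclear_rep T f y ->
  \sum_(0 <= n < N) weights f y n <= fine (rep_weight f y).
Proof. by move=> /nuclear_rep_fin fyE; move: N; apply/rep_weight_leP; rewrite -fyE. Qed.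

(** The weights of a representation are summable, so its tails vanish. *)
Lemma nuclear_rep_tail T f y (e : R) : nuclear_rep T f y -> 0 < e ->
  exists N, fine (rep_weight f y) - \sum_(0 <= n < N) weights f y n < e.
Proof.
move=> fyT e0; apply/not_existsP => /(_ _)/negP tail.
have : (rep_weight f y <= (fine (rep_weight f y) - e)%:E)%E.
  by apply/rep_weight_leP => N; have := tail N; rewrite -leNgt; lra.
by rewrite {1}(nuclear_rep_fin fyT) lee_fin; lra.
Qed.

(** Two representations are merged into one of the sum by listing their terms
    alternately; the weights add up. *)
Lemma nuclear_repD T S f y g z : nuclear_rep T f y -> nuclear_rep S g z ->
  nuclear_rep (T + S) (interleave f g) (interleave y z) /\
  nnorm (T + S) <= fine (rep_weight f y) + fine (rep_weight g z).
Proof.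
move=> fyT gzS.
have bI (V : normedModType K) (u v : nat -> V) :
    bounded_fun u -> bounded_fun v -> bounded_fun (interleave u v).
  move=> /bounded_funE[M uM] /bounded_funE[L vL]; apply/bounded_funE.
  exists (Num.max M L) => n; rewrite /interleave le_max.
  by case: odd; rewrite ?uM ?vL ?orbT.
have [bf by_ _ fyx] := fyT; have [bg bz _ gzx] := gzS.
apply: nuclear_rep_intro; [exact: bI|exact: bI| |].
  move=> N; rewrite (eq_bigr (interleave (weights f y) (weights g z))).
    rewrite sum_interleave; apply: lerD.
      exact: nuclear_rep_weights fyT.
    exact: nuclear_rep_weights gzS.
  by move=> n _; rewrite /weights /interleave; case: odd.
move=> x; rewrite (_ : series _ = (fun n =>
    series (fun n => f n x *: y n) (uphalf n) +
    series (fun n => g n x *: z n) n./2)); last first.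
  apply/funext => n; rewrite /series/= -sum_interleave; apply: eq_bigr => i _.
  by rewrite /interleave; case: odd.
apply: cvgD.
  exact: (cvg_comp _ _ cvg_uphalf (fyx x)).
exact: (cvg_comp _ _ cvg_half (gzx x)).
Qed.

Lemma nuclear_repZ (a : K) T f y : nuclear_rep T f y ->
  nuclear_rep (a *: T) (fun n => a *: f n) y /\
  nnorm (a *: T) <= rnorm (a : K^o) * fine (rep_weight f y).
Proof.
move=> fyT; have [/bounded_funE[M fM] by_ _ fyx] := fyT.
apply: nuclear_rep_intro => //.
- apply/bounded_funE; exists (rnorm (a : K^o) * M) => n.
  by rewrite rnormZ ler_wpM2l ?rnorm_ge0.
- move=> N; under eq_bigr do rewrite /weights rnormZ -mulrA.
  by rewrite -mulr_sumr ler_wpM2l ?rnorm_ge0// (nuclear_rep_weights _ fyT).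
- move=> x; rewrite (_ : series _ = a \*: series (fun n => f n x *: y n)).
    by apply: cvgZl_tmp; exact: fyx.
  apply/funext => n; rewrite /series/= scaler_sumr; apply: eq_bigr => i _.
  by rewrite /= scalerA.
Qed.

(** The remainder of a representation is a representation of the remainder. *)
Lemma nuclear_rep_shift T f y N : nuclear_rep T f y ->
  nnorm (fun x => T x - \sum_(0 <= n < N) f n x *: y n) <=
  fine (rep_weight f y) - \sum_(0 <= n < N) weights f y n.
Proof.
move=> fyT; have [/bounded_funE[M fM] /bounded_funE[L yL] _ fyx] := fyT.
have shift (V : zmodType) (u : nat -> V) n :
    \sum_(0 <= i < n) u (i + N)%N =
    \sum_(0 <= i < n + N) u i - \sum_(0 <= i < N) u i.
  rewrite [in RHS](@big_cat_nat _ _ _ N)//= ?leq_addl// addrAC subrr add0r.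
  by have := big_addn 0 (n + N) N xpredT u; rewrite add0n addnK => ->.
apply: (proj2 (@nuclear_rep_intro _ (fun n => f (n + N)%N)
  (fun n => y (n + N)%N) _ _ _ _ _)).
- by apply/bounded_funE; exists M => n.
- by apply/bounded_funE; exists L => n.
- by move=> n; rewrite (shift _ (weights f y)) lerD2r (nuclear_rep_weights _ fyT).
- move=> x; rewrite (_ : series _ = (fun n =>
    series (fun n => f n x *: y n) (n + N)%N - \sum_(0 <= n < N) f n x *: y n)).
    by apply: cvgB; [rewrite (cvg_shiftn N (series _))|exact: cvg_cst].
  by apply/funext => n; rewrite -(shift _ (fun n => f n x *: y n)).
Qed.

(** Padding with zeros makes a representation out of a finite sum. *)
Lemma nuclear_rep_finite (f : nat -> dual X) (y : nat -> Y) N :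
  let f0 n := if (n < N)%N then f n else 0 in
  let y0 n := if (n < N)%N then y n else 0 in
  nuclear_rep (fun x => \sum_(0 <= n < N) f n x *: y n) f0 y0 /\
  (rep_weight f0 y0 <= (\sum_(0 <= n < N) weights f y n)%:E)%E.
Proof.
move=> f0 y0.
have bd (V : normedModType K) (u : nat -> V) :
    bounded_fun (fun n => if (n < N)%N then u n else 0).
  apply/bounded_funE; exists (\sum_(n < N) rnorm (u n)) => n.
  case: ifPn => [nN|_]; last by rewrite rnorm0 sumr_ge0// => *; exact: rnorm_ge0.
  rewrite (bigD1 (Ordinal nN))//= lerDl sumr_ge0// => *; exact: rnorm_ge0.
have trunc (V : zmodType) (u : nat -> V) n :
    \sum_(0 <= i < n) (if (i < N)%N then u i else 0) =
    \sum_(0 <= i < minn n N) u i.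
  elim: n => [|n IHn]; first by rewrite min0n !big_nil.
  rewrite big_nat_recr//= IHn; have [nN|Nn] := ltnP n N.
    by rewrite (minn_idPl nN) big_nat_recr.
  by rewrite (minn_idPr (leqW Nn)) addr0.
have tw n : \sum_(0 <= i < n) weights f0 y0 i <= \sum_(0 <= i < N) weights f y i.
  rewrite (eq_bigr (fun i => if (i < N)%N then weights f y i else 0)).
    rewrite trunc [leRHS](@big_cat_nat _ _ _ (minn n N)) ?geq_minr//=.
    by rewrite lerDl sumr_ge0// => i _; exact: weights_ge0.
  by move=> i _; rewrite /weights /f0 /y0; case: ifP => // _; rewrite [rnorm (0 : Y)]rnorm0 mulr0.
split; last exact/rep_weight_leP.
apply: (proj1 (nuclear_rep_intro _ _ tw _)); [exact: bd|exact: bd|move=> x].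
apply: cvg_near_cst; near=> n; rewrite /series/=.
rewrite (eq_bigr (fun i => if (i < N)%N then f i x *: y i else 0)).
  by rewrite trunc (minn_idPr _)//; near: n; exact: nbhs_infty_ge.
by move=> i _; rewrite /f0 /y0; case: ifP => // _; rewrite scaler0.
Unshelve. all: by end_near. Qed.

End nuclear_theory.

(** * The space of nuclear operators *)

Section nuclear_operators.
Context {R : realType} {k : scalar_kind}.
Local Notation K := (scalars R k).
Variables X Y : normedModType K.
Implicit Types (f g : dual X) (y z : Y).

Definition nuclear_pred : {pred (X -> Y)} := fun T => `[< nuclear X Y T >].

Record nuclear_op :=
  NuclearOp { nuclear_fun :> X -> Y ; _ : nuclear_fun \in nuclear_pred }.

HB.instance Definition _ := [isSub for nuclear_fun].
HB.instance Definition _ := [Choice of nuclear_op by <:].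

Lemma nuclear_pred_submod_closed : submod_closed nuclear_pred.
Proof.
split.
  have [rep0 _] := nuclear_rep_finite (fun=> 0 : dual X) (fun=> 0 : Y) 0.
  suff <- : (fun x : X => \sum_(0 <= n < 0) (0 : dual X) x *: (0 : Y)) = 0.
    by apply/asboolP; do 2 eexists; exact: rep0.
  by apply/funext => x; rewrite big_nil.
move=> a S T /asboolP[f [y fyS]] /asboolP[g [z gzT]]; apply/asboolP.
have [rS _] := nuclear_repZ a fyS.
by have [rST _] := nuclear_repD rS gzT; do 2 eexists; exact: rST.
Qed.

HB.instance Definition _ :=
  GRing.isSubmodClosed.Build _ _ nuclear_pred nuclear_pred_submod_closed.
HB.instance Definition _ := [SubChoice_isSubLmodule of nuclear_op by <:].

Lemma nuclear_opP (T : nuclear_op) : nuclear X Y T.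
Proof. by case: T => T /= /asboolP. Qed.

Lemma nnorm_seminorm : seminorm (fun T : nuclear_op => nnorm T).
Proof.
split=> [S T|a T].
  apply/ler_addgt0Pr => e e0; have e20 : 0 < e / 2 by rewrite divr_gt0.
  have [f [y [fyS fye]]] := nnorm_adherent (nuclear_opP S) e20.
  have [g [z [gzT gze]]] := nnorm_adherent (nuclear_opP T) e20.
  by have [_] := nuclear_repD fyS gzT; lra.
apply/ler_addgt0Pr => e e0.
have ra0 := rnorm_ge0 (a : K^o); pose r := rnorm (a : K^o).
have r1 : 0 < r + 1 by rewrite ltr_wpDl.
have [f [y [fyT fye]]] := nnorm_adherent (nuclear_opP T) (divr_gt0 e0 r1).
have [_ aT] := nuclear_repZ a fyT; apply: le_trans aT _.
apply: le_trans (ler_wpM2l ra0 (ltW fye)) _; rewrite mulrDr lerD2l -/r.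
by rewrite mulrCA; apply: ler_piMr; [exact: ltW|rewrite ler_pdivrMr// mul1r lerDl].
Qed.

Lemma nuclear_rep_tensor f y :
  nuclear X Y (fun x => f x *: y) /\
  nnorm (fun x => f x *: y) <= rnorm f * rnorm y.
Proof.
have [] := nuclear_rep_finite (fun=> f) (fun=> y) 1.
have -> : (fun x => \sum_(0 <= n < 1) f x *: y) = (fun x => f x *: y).
  by apply/funext => x; rewrite big_nat1.
move=> rfy; rewrite big_nat1 => wfy; split; first by do 2 eexists; exact: rfy.
rewrite -lee_fin -nuclear_normE; last by do 2 eexists; exact: rfy.
exact: le_trans (nuclear_norm_le rfy) wfy.
Qed.

Definition tensor f y : nuclear_op :=
  NuclearOp (asboolT (proj1 (nuclear_rep_tensor f y))).

Lemma nnorm_tensor f y : nnorm (tensor f y) <= rnorm f * rnorm y.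
Proof. exact: (proj2 (nuclear_rep_tensor f y)). Qed.

Lemma tensor_linearl y : linear (tensor ^~ y).
Proof.
move=> a f g; apply: val_inj; apply/funext => x /=.
by rewrite [LHS]scalerDl -scalerA.
Qed.

Lemma tensor_linearr f : linear (tensor f).
Proof.
move=> a y z; apply: val_inj; apply/funext => x /=.
by rewrite [LHS]scalerDr scalerA mulrC -scalerA.
Qed.

Lemma tensor0 f : tensor f 0 = 0.
Proof. by apply: val_inj; apply/funext => x; exact: scaler0. Qed.

Lemma sum_tensorE (f : nat -> dual X) (y : nat -> Y) N :
  \sum_(0 <= n < N) tensor (f n) (y n) =
  (fun x => \sum_(0 <= n < N) f n x *: y n) :> (X -> Y).
Proof.
apply/funext => x; elim: N => [|N IHN]; first by rewrite !big_nil.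
by rewrite !big_nat_recr//= -IHN.
Qed.

Lemma nnorm_remainder (T : nuclear_op) (f : nat -> dual X) (y : nat -> Y) N :
  nuclear_rep T f y ->
  nnorm (nuclear_fun (T - \sum_(0 <= n < N) tensor (f n) (y n))) <=
  fine (rep_weight f y) - \sum_(0 <= n < N) weights f y n.
Proof.
move=> /(nuclear_rep_shift N); congr (nnorm _ <= _); apply/funext => x.
by have /(congr1 (@^~ x)) /= <- := sum_tensorE f y N.
Qed.

(** Hahn-Banach functionals on the nuclear operators are used through the
    bilinear forms that they induce on elementary tensors. *)
Lemma form_of_functional (G : {linear nuclear_op -> K^o}) :
  exists B : {bilinear dual X -> Y -> K^o}, forall f y, B f y = G (tensor f y).
Proof.
pose B0 f y := G (tensor f y).
have B0l y : linear (B0^~ y) by move=> a f g; rewrite /B0 tensor_linearl linearP.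
have B0r f : linear (B0 f) by move=> a y z; rewrite /B0 tensor_linearr linearP.
pose bil := bilinear_isBilinear.Build K (dual X) Y K^o *:%R *:%R B0 (B0l, B0r).
pose B : {bilinear dual X -> Y -> K^o} := HB.pack B0 bil.
by exists B.
Qed.

End nuclear_operators.

(** * Replacing the terms of a near-optimal representation *)

Section normalization.
Context {R : realType} {k : scalar_kind}.
Local Notation K := (scalars R k).

Lemma normalize (V : normedModType K) (x : V) : rnorm x != 0 ->
  exists2 x', rnorm x' = 1 & x = of_real k (rnorm x) *: x'.
Proof.
move=> x0; have rx0 : of_real k (rnorm x) != 0.
  by apply: contra x0 => /eqP rx; rewrite -(of_realK (k := k) (rnorm x)) rx
    real_part0.
exists ((of_real k (rnorm x))^-1 *: x).
  by rewrite rnormZ rnormV// rnorm_of_real ?rnorm_ge0// mulVf.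
by rewrite scalerA mulfV// scale1r.
Qed.

Variables (E F : normedModType K) (B : {bilinear E -> F -> K^o}).

Lemma form_norm_ge0 : bounded_form B -> 0 <= form_norm B.
Proof.
move=> bB; have [B0|/set0P[r Br]] := eqVneq (form_values B) set0.
  by rewrite /form_norm B0 sup0.
apply: le_trans (ub_le_sup bB Br); case: Br => p _ <-; exact: rnorm_ge0.
Qed.

Lemma form_norm_ub x y :
  bounded_form B -> rnorm (B x y) <= form_norm B * (rnorm x * rnorm y).
Proof.
move=> bB.
have [x0|x0] := eqVneq (rnorm x) 0.
  by rewrite (rnorm_eq0 x0) linear0l !rnorm0 mul0r mulr0.
have [y0|y0] := eqVneq (rnorm y) 0.
  by rewrite (rnorm_eq0 y0) linear0r !rnorm0 !mulr0.
have [x' x'1 xE] := normalize x0; have [y' y'1 yE] := normalize y0.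
rewrite {1}xE {1}yE linearZl_LR linearZr_LR !rnormZ !rnorm_of_real ?rnorm_ge0//.
rewrite mulrA mulrC ler_wpM2r ?mulr_ge0 ?rnorm_ge0//.
by apply: ub_le_sup => //; exists (x', y').
Qed.

End normalization.

Section approximation.
Context {R : realType} {k : scalar_kind}.
Local Notation K := (scalars R k).
Variables X Y : normedModType K.
Implicit Types (T S : nuclear_op X Y) (f g : dual X) (y z : Y).
Local Notation nu T := (nnorm (nuclear_fun T)).

Let nuD S T : nu (S + T) <= nu S + nu T := (nnorm_seminorm X Y).1 S T.
Let nuZ a T : nu (a *: T) <= rnorm (a : K^o) * nu T := (nnorm_seminorm X Y).2 a T.

Let tensorBl f g y : tensor (f - g) y = tensor f y - tensor g y.
Proof. by have := tensor_linearl y (-1) g f; rewrite !scaleN1r !(addrC (- _)). Qed.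

Let tensorBr f y z : tensor f (y - z) = tensor f y - tensor f z.
Proof. by have := tensor_linearr f (-1) z y; rewrite !scaleN1r !(addrC (- _)). Qed.

Let tensorZl a f y : tensor (a *: f) y = a *: tensor f y.
Proof. by apply: val_inj; apply/funext => x /=; rewrite [RHS]scalerA. Qed.

Let tensorZr a f y : tensor f (a *: y) = a *: tensor f y.
Proof. by apply: val_inj; apply/funext => x /=; rewrite [RHS]scalerA [LHS]scalerA mulrC. Qed.

(** A functional of norm at most one bounds the nuclear norm from below, so a
    finite sum of tensors on which it recovers the whole weight has no cheaper
    representation. *)
Lemma attaining_finite (G : {linear nuclear_op X Y -> K^o})
    (f : nat -> dual X) (y : nat -> Y) N :
  (forall T, rnorm (G T) <= nu T) ->
  (forall n, weights f y n <= real_part (G (tensor (f n) (y n)))) ->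
  nuclear_attaining X Y (\sum_(0 <= n < N) tensor (f n) (y n) : nuclear_op X Y).
Proof.
move=> Gnu fyG; set S := \sum_(0 <= n < N) _.
have [rS wS] := nuclear_rep_finite f y N; rewrite -sum_tensorE -/S in rS.
do 2 eexists; split; first exact: rS.
apply/eqP; rewrite eq_le (nuclear_norm_le rS)/=.
apply: le_trans wS _; rewrite nuclear_normE ?lee_fin; last exact: nuclear_opP.
apply: le_trans (Gnu S); apply: le_trans (real_part_le _).
by rewrite /S linear_sum real_part_sum ler_sum.
Qed.

(** If [Re G (f' (x) y')] is close to one for the normalized factors
    [(f', y')], then [c = G (g (x) z)] has modulus one at some [(g, z)] nearby;
    [c] itself is close to one, so [|f| |y| c^-1 g (x) z] is a good replacement,
    on which [G] takes the value [|f| |y|]. Otherwise the weight [|f| |y|] is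
    at most [d^-1] times the defect [|f| |y| - Re G (f (x) y)], and the
    replacement is zero. *)
Lemma replace_tensor (G : {linear nuclear_op X Y -> K^o}) (e d : R) f y :
  (forall T, rnorm (G T) <= nu T) -> 0 < e -> 0 < d -> 2 * d <= e ^+ 2 ->
  (forall f y, unit_sphere (dual X) f -> unit_sphere Y y ->
    1 - d < rnorm (G (tensor f y)) ->
    exists g z, [/\ unit_sphere (dual X) g, unit_sphere Y z,
      rnorm (G (tensor g z)) = 1, rnorm (f - g) < e & rnorm (y - z) < e]) ->
  exists g z, rnorm g * rnorm z <= real_part (G (tensor g z)) /\
    nu (tensor f y - tensor g z) <= 5 * e * (rnorm f * rnorm y) +
      d^-1 * (rnorm f * rnorm y - real_part (G (tensor f y))).
Proof.
move=> Gnu e0 d0 de Loo; set w := rnorm f * rnorm y.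
have w0 : 0 <= w by rewrite mulr_ge0 ?rnorm_ge0.
have Gw : real_part (G (tensor f y)) <= w.
  apply: le_trans (real_part_le _) _; apply: le_trans (Gnu _) _.
  exact: nnorm_tensor.
have drop : real_part (G (tensor f y)) <= (1 - d) * w ->
    exists g z, rnorm g * rnorm z <= real_part (G (tensor g z)) /\
    nu (tensor f y - tensor g z) <= 5 * e * w +
      d^-1 * (w - real_part (G (tensor f y))).
  move=> Gd; exists 0, 0.
  rewrite tensor0 (linear0 G) real_part0 subr0 [rnorm (0 : Y)]rnorm0 mulr0; split=> //.
  apply: le_trans (nnorm_tensor f y) _; rewrite -/w.
  have ew0 : 0 <= 5 * e * w by do 2 (apply: mulr_ge0 => //); exact: ltW.
  have : w <= d^-1 * (w - real_part (G (tensor f y))).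
    by rewrite ler_pdivlMl//; lra.
  by lra.
have [fy0|fy0] := eqVneq w 0.
  by apply: drop; rewrite fy0 mulr0 -fy0.
have [|Gd] := leP (real_part (G (tensor f y))) ((1 - d) * w); first exact: drop.
have wgt0 : 0 < w by rewrite lt_neqAle eq_sym fy0.
have [f0 y0] : rnorm f != 0 /\ rnorm y != 0.
  by apply/andP; rewrite -negb_or -mulf_eq0.
have [f' f'1 fE] := normalize f0; have [y' y'1 yE] := normalize y0.
have tE : tensor f y = of_real k w *: tensor f' y'.
  by rewrite [in LHS]fE [in LHS]yE tensorZl tensorZr scalerA -of_realM.
pose b : K := G (tensor f' y').
have Gb : real_part (G (tensor f y)) = w * real_part b.
  by rewrite tE linearZ_LR real_partM_of_real.
have b1 : 1 - d < real_part b by move: Gd; rewrite Gb mulrC ltr_pM2l.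
have [g [z [g1 z1 c1 fg yz]]] : exists g z, [/\ unit_sphere (dual X) g,
    unit_sphere Y z, rnorm (G (tensor g z)) = 1, rnorm (f' - g) < e &
    rnorm (y' - z) < e].
  by apply: Loo => //; apply: lt_le_trans b1 (real_part_le _).
pose c : K := G (tensor g z).
have rc1 : rnorm (c : K^o) = 1 by [].
have c0 : c != 0.
  by apply/eqP => cE; move: rc1; rewrite cE rnorm0 => /eqP; rewrite eq_sym oner_eq0.
have bnu : rnorm (b : K^o) <= 1.
  apply: le_trans (Gnu _) _; apply: le_trans (nnorm_tensor _ _) _.
  by rewrite f'1 y'1 mulr1.
have b1e : rnorm (1 - b : K^o) <= e.
  rewrite -(@ler_pXn2r _ 2)// ?nnegrE ?rnorm_ge0 ?(ltW e0)//.
  by apply: le_trans (rnorm_1B_sqr bnu) _; lra.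
pose D := tensor (f' - g) y' + tensor g (y' - z).
have DE : D = tensor f' y' - tensor g z by rewrite /D tensorBl tensorBr addrA subrK.
have nuDe : nu D <= e + e.
  apply: le_trans (nuD _ _) _; apply: lerD.
    by apply: le_trans (nnorm_tensor _ _) _; rewrite y'1 mulr1 ltW.
  by apply: le_trans (nnorm_tensor _ _) _; rewrite g1 mul1r ltW.
have cb : rnorm (b - c : K^o) <= e + e.
  apply: le_trans nuDe; apply: le_trans (Gnu _).
  by rewrite DE linearB.
have cV : rnorm (1 - c^-1 : K^o) <= 3 * e.
  have -> : 1 - c^-1 = - (c^-1 * (1 - b + (b - c))).
    by rewrite addrA subrK mulrBr mulr1 mulVf// opprB.
  rewrite -mulNr rnormM -[- c^-1]mulN1r rnormM rnormV// rc1 invr1 mulr1.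
  have -> : rnorm (-1 : K^o) = 1.
    by apply: (can_inj (@of_realK R k)); rewrite of_rnorm normrN1 of_real1.
  rewrite mul1r; apply: le_trans (rnormD _ _) _; lra.
(* Normalized error: [2 e] from moving the pair and [3 e] from the rotation. *)
exists ((of_real k w * c^-1) *: g), z.
rewrite tensorZl linearZ_LR rnormZ rnormM rnormV// rc1 g1 z1 invr1 !mulr1.
rewrite rnorm_of_real//; split.
  rewrite -/c.
  have -> : (of_real k w / c) *: c = of_real k w by rewrite /GRing.scale/= mulfVK.
  by rewrite of_realK.
have -> : tensor f y - (of_real k w / c) *: tensor g z =
    of_real k w *: (D + (1 - c^-1) *: tensor g z).
  rewrite tE -scalerA -scalerBr DE; congr (_ *: _).
  by rewrite scalerBl scale1r addrA subrK.
apply: le_trans (nuZ _ _) _; rewrite rnorm_of_real//.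
apply: (@le_trans _ _ (w * (5 * e))).
  rewrite ler_wpM2l//; apply: le_trans (nuD _ _) _.
  have : nu ((1 - c^-1) *: tensor g z) <= 3 * e.
    apply: le_trans (nuZ _ _) _; apply: le_trans cV.
    rewrite -[leRHS]mulr1 ler_wpM2l ?rnorm_ge0//.
    by apply: le_trans (nnorm_tensor _ _) _; rewrite g1 z1 mulr1.
  lra.
rewrite mulrC lerDl; apply: mulr_ge0; rewrite ?subr_ge0//.
by rewrite invr_ge0 ltW.
Qed.

End approximation.

(** * The norming form and the approximation *)

Section norming.
Context {R : realType} {k : scalar_kind}.
Local Notation K := (scalars R k).
Variables X Y : normedModType K.
Local Notation nu T := (nnorm (nuclear_fun T)).
Variables (G : {linear nuclear_op X Y -> K^o}) (T : nuclear_op X Y).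
Hypothesis Gnu : forall S, rnorm (G S) <= nu S.
Hypothesis GT : real_part (G T) = nu T.

(** [G] sees the remainder after [N] terms by at most its nuclear norm, which
    the tail of the weights controls. *)
Lemma norming_partial_sum (f : nat -> dual X) (y : nat -> Y) N :
  nuclear_rep T f y ->
  nu T <= \sum_(0 <= n < N) real_part (G (tensor (f n) (y n))) +
    (fine (rep_weight f y) - \sum_(0 <= n < N) weights f y n).
Proof.
move=> fyT; pose S := \sum_(0 <= n < N) tensor (f n) (y n).
have GTS : G T = G S + G (T - S) by rewrite linearB addrC subrK.
rewrite -GT GTS real_partD {1}/S linear_sum real_part_sum lerD2l.
apply: le_trans (real_part_le _) _; apply: le_trans (Gnu _) _.
exact: nnorm_remainder.
Qed.

Variable B : {bilinear dual X -> Y -> K^o}.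
Hypothesis BG : forall f y, B f y = G (tensor f y).

Lemma norming_form_bounded : ubound (form_values B) 1.
Proof.
move=> _ [[f y] /= [f1 y1] <-]; rewrite BG; apply: le_trans (Gnu _) _.
by apply: le_trans (nnorm_tensor _ _) _; rewrite f1 y1 mulr1.
Qed.

(** Summing [Re B (f n) (y n) <= |B| |f n| |y n|] over representations of
    weight close to [nu T] gives [nu T <= |B| nu T]. *)
Lemma norming_form_norm : 0 < nu T -> form_norm B = 1.
Proof.
move=> T0; have bB : bounded_form B by exists 1; exact: norming_form_bounded.
have B0 := form_norm_ge0 bB; have B1 : form_norm B <= 1.
  have [Bv0|/set0P Bv0] := eqVneq (form_values B) set0.
    by rewrite /form_norm Bv0 sup0 ler01.
  by apply: ge_sup => //; exact: norming_form_bounded.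
apply/eqP; rewrite eq_le B1/= -(ler_pM2r T0) mul1r.
apply/ler_addgt0Pr => e e0; have e20 : 0 < e / 2 by rewrite divr_gt0.
have [f [y [fyT fye]]] := nnorm_adherent (nuclear_opP T) e20.
have [N] := nuclear_rep_tail fyT e20.
have := norming_partial_sum N fyT.
have : \sum_(0 <= n < N) real_part (G (tensor (f n) (y n))) <=
    form_norm B * \sum_(0 <= n < N) weights f y n.
  rewrite mulr_sumr ler_sum// => n _; apply: le_trans (real_part_le _) _.
  by rewrite -BG; exact: form_norm_ub.
have := nuclear_rep_weights N fyT.
set s := \sum_(_ <= _ < _) weights _ _ _; set W := fine _ in fye *.
move=> sW H1 H2 H3; have : form_norm B * s <= form_norm B * (nu T + e / 2).
  by rewrite ler_wpM2l//; lra.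
have : form_norm B * (e / 2) <= e / 2 by rewrite ler_piMl// ltW.
by rewrite mulrDr; lra.
Qed.

End norming.

(** The error consists of the remainder after [N] terms, at most [e1], the
    replacement errors, at most [5 e1] times the weight, and the dropped
    terms: their weight is at most [d^-1] times the sum of the defects, and
    this sum is at most [d * e1] by the choice of the representation. *)
Lemma nuclear_approximation (R : realType) (k : scalar_kind)
    (X Y : normedModType (scalars R k)) (T : nuclear_op X Y) (e : R) :
  property_Loo (dual X) Y -> 0 < e ->
  exists2 S : nuclear_op X Y, nuclear_attaining X Y S &
    nnorm (nuclear_fun (T - S)) < e.
Proof.
move=> Loo e0.
have nuD S1 S2 := (nnorm_seminorm X Y).1 S1 S2; rewrite /= in nuD.
have [G [Gnu GT]] := norming_functional T (nnorm_seminorm X Y); rewrite /= in Gnu GT.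
set P := nnorm T in GT; have P0 : 0 <= P by exact: nnorm_ge0.
have [P00|Pn0] := eqVneq P 0.
  exists (\sum_(0 <= n < 0) tensor 0 0).
    apply: (@attaining_finite _ _ _ _ G (fun=> 0) (fun=> 0)) => [//|n].
    by rewrite /weights [rnorm (0 : Y)]rnorm0 mulr0 tensor0 linear0 real_part0.
  by rewrite big_nil subr0 -/P P00.
have Pgt0 : 0 < P by rewrite lt_neqAle eq_sym Pn0.
have [B BG] := form_of_functional G.
have bB : bounded_form B by exists 1; exact: norming_form_bounded Gnu B BG.
have B1 : form_norm B = 1 by exact: norming_form_norm Gnu GT B BG Pgt0.
(* The total error is [2 e1 + 5 e1 (P + 1) < C e1]; [d] is below the modulus
   [eta], and small enough that [|b| <= 1] and [Re b > 1 - d] force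
   [|1 - b| <= e1]. *)
pose C : R := 5 * (P + 1) + 3; have C0 : 0 < C by rewrite /C; lra.
pose e1 := Num.min 1 (e / C).
have e10 : 0 < e1 by rewrite lt_min ltr01 divr_gt0.
have e11 : e1 <= 1 by rewrite ge_min lexx.
have e1C : e1 * C <= e by rewrite -ler_pdivlMr// ge_min lexx orbT.
have [eta eta0 LooB] := Loo e1 B e10 bB B1.
pose d := Num.min eta (e1 ^+ 2 / 2).
have d0 : 0 < d by rewrite lt_min eta0 divr_gt0// exprn_gt0.
have deta : d <= eta by rewrite ge_min lexx.
have de1 : 2 * d <= e1 ^+ 2 by rewrite mulrC -ler_pdivlMr// ge_min lexx orbT.
have LooG f y : unit_sphere (dual X) f -> unit_sphere Y y ->
    1 - d < rnorm (G (tensor f y)) ->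
    exists g z, [/\ unit_sphere (dual X) g, unit_sphere Y z,
      rnorm (G (tensor g z)) = 1, rnorm (f - g) < e1 & rnorm (y - z) < e1].
  move=> f1 y1; rewrite -BG => Bfy.
  have [|g [z [g1 z1 Bgz fg yz]]] := LooB f y f1 y1; first lra.
  by exists g, z; rewrite -BG.
have de10 : 0 < d * e1 by rewrite mulr_gt0.
have [f [y [fyT fyP]]] := nnorm_adherent (nuclear_opP T) de10.
have [N tail] := nuclear_rep_tail fyT e10.
have repl n := replace_tensor (f n) (y n) Gnu e10 d0 de1 LooG.
have /choice[g /choice[z gz]] := repl.
pose S := \sum_(0 <= n < N) tensor (g n) (z n).
pose S0 := \sum_(0 <= n < N) tensor (f n) (y n).
exists S; first by apply: (attaining_finite (G := G)) => // n; have [] := gz n.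
have TS0 : nnorm (nuclear_fun (T - S0)) <= e1.
  by apply: le_trans (nnorm_remainder N fyT) _; exact: ltW.
set W := fine (rep_weight f y) in fyP tail.
pose s := \sum_(0 <= n < N) weights f y n.
pose r := \sum_(0 <= n < N) real_part (G (tensor (f n) (y n))).
have S0S : nnorm (nuclear_fun (S0 - S)) <= 5 * e1 * s + d^-1 * (s - r).
  rewrite /S0 /S /s /r -!sumrB mulr_sumr mulr_sumr -big_split/=.
  elim: N {tail S S0 TS0 s r} => [|N IHN].
    rewrite !big_nil; have := (nnorm_seminorm X Y).2 0 0.
    by rewrite scale0r [rnorm (0 : _^o)]rnorm0 mul0r.
  rewrite !big_nat_recr//; apply: le_trans (nuD _ _) _; apply: lerD => //.
  by have [_] := gz N.
have -> : T - S = (T - S0) + (S0 - S) by rewrite addrA subrK.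
apply: le_lt_trans (nuD _ _) _.
have sW : s <= W := nuclear_rep_weights N fyT.
have sr : s - r <= d * e1.
  by have := norming_partial_sum Gnu GT N fyT; rewrite -/s -/r -/W; lra.
have dsr : d^-1 * (s - r) <= e1 by rewrite ler_pdivrMl.
have d1 : d <= 1.
  have : e1 ^+ 2 <= 1 by rewrite expr_le1// ltW.
  lra.
have de1le : d * e1 <= 1 by rewrite mulr_ile1// ltW.
have : 5 * e1 * s <= 5 * e1 * (P + 1).
  by rewrite ler_wpM2l ?mulr_ge0 ?(ltW e10)//; rewrite -/P in fyP; lra.
by move: e1C; rewrite /C; lra.
Qed.

Theorem proposition4p3 (R : realType) (k : scalar_kind)
    (X Y : completeNormedModType (scalars R k)) :
  property_Loo (dual X) Y ->
  nuclear_closure (nuclear_attaining X Y) = nuclear X Y.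
Proof.
move=> Loo; apply/seteqP; split=> [T [] //|T nT]; split=> // e e0.
have [S attS TSe] := nuclear_approximation (NuclearOp (asboolT nT)) Loo e0.
exists S => //; have nTS := nuclear_opP (NuclearOp (asboolT nT) - S).
by rewrite (nuclear_normE nTS) lte_fin.
Qed.
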